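(* Let $X,Y$ be Banach spaces and let $T\in B(X,Y)$ be such that $\mathcal N(T)$ and $\mathcal R(T)$ are Chebyshev subspaces of $X$ and $Y$, respectively, with Moore--Penrose metric generalized inverse $T^M$. Let $\delta T\in B(X,Y)$ be such that $T^M$ is quasi-additive on $\mathcal R(\delta T)$ and $\|T^M\delta T\|<1$. Put $\bar T=T+\delta T$, let $b\in\mathcal R(T)\cap\mathcal R(\bar T)$ with $b\ne0$, and let $S(T,b)=\{x\in X: Tx=b\}$, $S(\bar T,b)=\{z\in X:\bar Tz=b\}$. Put $\kappa=\|T^M\|\,\|T\|$ and $\epsilon_T=\|\delta T\|/\|T\|$. If $T^M$ is quasi-additive on $\mathcal R(T)$, then: (1) for any $z\in S(\bar T,b)$ there exists $x\in S(T,b)$ such that $\dfrac{\|z-x\|}{\|z\|}\le\kappa\,\epsilon_T$; (2) for any $z\in S(\bar T,b)$ there exists $x\in S(T,b)$ such that $\dfrac{\|z-x\|}{\|x\|}\le\dfrac{\kappa\,\epsilon_T}{1-\|T^M\delta T\|}$.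
   Context: $B(X,Y)$ is the space of bounded linear operators from $X$ to $Y$; $\mathcal N(\cdot)$ and $\mathcal R(\cdot)$ denote null space and range. A bounded homogeneous operator $A:Y\to X$ is a map sending bounded sets to bounded sets with $A(\lambda y)=\lambda A(y)$ for all $y\in Y$, $\lambda\in\mathbb R$; its norm is $\|A\|=\sup\{\|Ay\|:\|y\|=1\}$. A map $A:Y\to X$ is quasi-additive on $M\subset Y$ if $A(y+z)=A(y)+A(z)$ for all $y\in Y$, $z\in M$. A subspace $G$ of a Banach space $Z$ is Chebyshev if each $z\in Z$ has exactly one nearest point in $G$, denoted $\pi_G(z)$; $\pi_G$ is the metric projector onto $G$. For $T\in B(X,Y)$ with $\mathcal N(T)$, $\mathcal R(T)$ Chebyshev, the Moore--Penrose metric generalized inverse of $T$ is the (existing and unique) bounded homogeneous operator $T^M:Y\to X$ with $TT^MT=T$, $T^MTT^M=T^M$, $T^MT=I_X-\pi_{\mathcal N(T)}$, $TT^M=\pi_{\mathcal R(T)}$. Products of operators denote composition; since $T^M$ is quasi-additive on $\mathcal R(\delta T)$, $T^M\delta T$ is a bounded linear operator on $X$. *)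

(* Defs.v *)
From HB Require Import structures.
From mathcomp Require Import all_boot all_order all_algebra.
From mathcomp Require Import all_classical all_reals all_analysis.

Set Implicit Arguments.
Unset Strict Implicit.
Unset Printing Implicit Defensive.

Import Order.TTheory GRing.Theory Num.Theory.
Import numFieldNormedType.Exports.

Local Open Scope classical_set_scope.
Local Open Scope ring_scope.

(* [sup] returns 0 on sets that are empty or unbounded above: this is the
   operator norm when [A] is bounded, and 0 on the zero space. *)
Definition op_norm (R : realType) (V W : normedModType R) (A : V -> W) : R :=
  sup [set `|A v| | v in [set v : V | `|v| = 1]].

(* [bounded_fun_norm A] says that [A] maps bounded sets to bounded sets; for a
   linear map this is membership in B(V, W). *)
Definition bounded_homogeneous (R : realType) (V W : normedModType R)
    (A : V -> W) : Prop :=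
  bounded_fun_norm A /\ scalable A.

Definition quasi_additive (R : realType) (V W : normedModType R)
    (A : V -> W) (M : set V) : Prop :=
  forall y z, M z -> A (y + z) = A y + A z.

Definition null_space (R : realType) (V W : normedModType R)
    (T : {linear V -> W}) : set V :=
  T @^-1` [set 0].

Definition solution_set (R : realType) (V W : normedModType R)
    (T : V -> W) (b : W) : set V :=
  T @^-1` [set b].

Definition nearest_points (R : realType) (Z : normedModType R)
    (G : set Z) (z : Z) : set Z :=
  [set p | G p /\ forall g, G g -> `|z - p| <= `|z - g|].

Definition chebyshev_subspace (R : realType) (Z : normedModType R)
    (G : set Z) : Prop :=
  submod_closed (mem G) /\ forall z, exists! p, nearest_points G z p.

(* The default value 0 is irrelevant when [G] is Chebyshev. *)
Definition metric_projector (R : realType) (Z : normedModType R)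
    (G : set Z) (z : Z) : Z :=
  xget 0 (nearest_points G z).

Definition moore_penrose_metric_inverse (R : realType) (X Y : normedModType R)
    (T : {linear X -> Y}) (TM : Y -> X) : Prop :=
  bounded_homogeneous TM /\
  [/\ T \o TM \o T = T :> (X -> Y),
      TM \o T \o TM = TM,
      TM \o T = (fun x => x - metric_projector (null_space T) x)
    & T \o TM = metric_projector (range T)].

(* Main.v *)
Require Import Defs.
From HB Require Import structures.
From mathcomp Require Import all_boot all_order all_algebra.
From mathcomp Require Import all_classical all_reals all_analysis.

Set Implicit Arguments.
Unset Strict Implicit.
Unset Printing Implicit Defensive.

Import Order.TTheory GRing.Theory Num.Theory.
Import numFieldNormedType.Exports.

Local Open Scope classical_set_scope.
Local Open Scope ring_scope.

(** A solution [z] of the perturbed equation is corrected to [x = z + TM (dT z)]. Since [b] lies in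
    the range of [T], so does [dT z = b - T z]; the identity [T TM T = T] then gives
    [T (TM (dT z)) = dT z], whence [T x = b]. The error is [TM (dT z)] up to sign, of norm at most
    [op_norm TM * op_norm dT * |z|], and the constant is [kappa * eps_T]. This is (1). For (2), [|x|
    >= |z| - |TM (dT z)| >= (1 - op_norm (TM \o dT)) * |z|] trades [|z|] for [|x|]. The norm
    estimates rest on [le_op_norm]. *)

Lemma op_norm_ge0 (R : realType) (V W : normedModType R) (A : V -> W) :
  0 <= op_norm A.
Proof.
rewrite /op_norm; set S := (X in sup X).
(* Where no supremum exists, the default value 0 of [sup] settles the claim. *)
have [supS|/sup_out ->//] := pselect (has_sup S).
have [_ [v v1 _]] := supS.1.
apply: (le_trans (normr_ge0 (A v))).
by apply: sup_upper_bound => //; exists v.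
Qed.

(** Rescaling [v] to the unit sphere uses homogeneity only, so the bound covers the possibly
    nonlinear [TM]. Boundedness on the unit ball makes the supremum a genuine upper bound. *)
Lemma le_op_norm (R : realType) (V W : normedModType R) (A : V -> W) (v : V) :
  bounded_homogeneous A -> `|A v| <= op_norm A * `|v|.
Proof.
move=> [bndA scA].
have [->|v_neq0] := eqVneq v 0.
  by rewrite -(scale0r (0 : V)) scA !scale0r !normr0 mulr0.
have nv_gt0 : 0 < `|v| by rewrite normr_gt0.
rewrite -ler_pdivrMr//.
have -> : `|A v| / `|v| = `|A (`|v|^-1 *: v)|.
  by rewrite scA normrZ ger0_norm ?invr_ge0// mulrC.
apply: ub_le_sup; last first.
  by exists (`|v|^-1 *: v) => //=; rewrite normrZ normfV normr_id mulVf ?gt_eqF.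
have [M MA] := bndA 1; exists M => _ [u /= u1 <-].
by apply: MA; rewrite u1.
Qed.

Lemma bounded_homogeneous_comp (R : realType) (U V W : normedModType R)
    (A : V -> W) (B : U -> V) :
  bounded_homogeneous A -> bounded_homogeneous B -> bounded_homogeneous (A \o B).
Proof.
move=> [bndA scA] [bndB scB]; split=> [r|k u] /=; last by rewrite scB scA.
have [M MB] := bndB r; have [N NA] := bndA M.
by exists N => u /MB /NA.
Qed.

Lemma linear_bounded_homogeneous (R : realType) (V W : normedModType R)
    (T : {linear V -> W}) : bounded_fun_norm T -> bounded_homogeneous T.
Proof. by split=> // k v; exact: linearZ. Qed.

Lemma op_norm_gt0 (R : realType) (V W : normedModType R) (A : V -> W) (v : V) :
  bounded_homogeneous A -> A v != 0 -> 0 < op_norm A.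
Proof.
move=> bhA Av_neq0; rewrite lt_def op_norm_ge0 andbT.
apply: contraNneq Av_neq0 => A0.
by have := le_op_norm v bhA; rewrite A0 mul0r normr_le0.
Qed.

Theorem theorem4p1 (R : realType) (X Y : completeNormedModType R)
    (T : {linear X -> Y}) (T_bounded : bounded_fun_norm T)
    (kerT_chebyshev : chebyshev_subspace (null_space T))
    (ranT_chebyshev : chebyshev_subspace (range T))
    (TM : Y -> X) (TM_inverse : moore_penrose_metric_inverse T TM)
    (dT : {linear X -> Y}) (dT_bounded : bounded_fun_norm dT)
    (TM_quasi_dT : quasi_additive TM (range dT))
    (TMdT_lt1 : op_norm (TM \o dT) < 1)
    (b : Y) (b_range : (range T `&` range (T \+ dT)) b) (b_neq0 : b != 0)
    (TM_quasi_T : quasi_additive TM (range T)) :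
  let kappa := op_norm TM * op_norm T in
  let eps_T := op_norm dT / op_norm T in
  (forall z, solution_set (T \+ dT) b z ->
     exists2 x, solution_set T b x &
       `|z - x| / `|z| <= kappa * eps_T) /\
  (forall z, solution_set (T \+ dT) b z ->
     exists2 x, solution_set T b x &
       `|z - x| / `|x| <= kappa * eps_T / (1 - op_norm (TM \o dT))).
Proof.
move=> kappa eps_T.
have [bhTM [TTMT _ _ _]] := TM_inverse.
have TTMTx x : T (TM (T x)) = T x.
  by rewrite -[in RHS]TTMT.
have bhdT := linear_bounded_homogeneous dT_bounded.
have bhTMdT := bounded_homogeneous_comp bhTM bhdT.
have [[w _ Tw] _] := b_range.
(* [T] does not vanish at [w], as [T w = b] is nonzero; so [op_norm T] may be cancelled in
   [kappa * eps_T]. *)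
have T_gt0 : 0 < op_norm T.
  apply: (@op_norm_gt0 _ _ _ _ w); first exact: linear_bounded_homogeneous.
  by rewrite Tw.
have kappa_epsE : kappa * eps_T = op_norm TM * op_norm dT.
  by rewrite /kappa /eps_T mulrACA mulfV ?gt_eqF// mulr1.
have z_gt0 z : solution_set (T \+ dT) b z -> 0 < `|z|.
  move=> /= Tz; rewrite normr_gt0; apply: contraNneq b_neq0 => z0.
  by rewrite -Tz z0 /= !linear0 addr0.
(* Since [dT z = b - T z] lies in [range T], the operator [T \o TM] fixes it. *)
have solT z : solution_set (T \+ dT) b z -> solution_set T b (z + TM (dT z)).
  move=> /= Tz; have dTz : dT z = T (w - z) by rewrite linearB Tw -Tz addrC addKr.
  by rewrite /solution_set/= linearD -Tz dTz TTMTx -dTz.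
have dist z : `|z - (z + TM (dT z))| = `|(TM \o dT) z|.
  by rewrite opprD addrA subrr sub0r normrN.
have le_kappa_eps z : `|(TM \o dT) z| <= kappa * eps_T * `|z|.
  rewrite kappa_epsE -mulrA; apply: le_trans (le_op_norm _ bhTM) _.
  by rewrite ler_wpM2l ?op_norm_ge0// le_op_norm.
split=> z Tz; exists (z + TM (dT z)); rewrite ?dist; try exact: solT.
  by rewrite ler_pdivrMr ?z_gt0.
have q_gt0 : 0 < 1 - op_norm (TM \o dT) by rewrite subr_gt0.
(* Reverse triangle inequality; with [TMdT_lt1] it also shows that the corrected solution is
   nonzero. *)
have z_le : (1 - op_norm (TM \o dT)) * `|z| <= `|z + TM (dT z)|.
  apply: le_trans (lerB_normD _ _).
  by rewrite mulrBl mul1r lerB// (le_op_norm z bhTMdT).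
have x_gt0 : 0 < `|z + TM (dT z)|.
  by apply: lt_le_trans z_le; rewrite mulr_gt0 ?z_gt0.
(* After factoring out [kappa * eps_T], what remains is [z_le] divided by
   [1 - op_norm (TM \o dT)]. *)
rewrite ler_pdivrMr// -[leRHS]mulrA; apply: le_trans (le_kappa_eps z) _.
rewrite ler_wpM2l//; first by rewrite kappa_epsE mulr_ge0 ?op_norm_ge0.
by rewrite ler_pdivlMl.
Qed.
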